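(* Let $\mathcal{L}=(L,\vee,\wedge,',0,1)$ be an orthomodular lattice and define two binary operations $\oplus$ and $\odot$ on $L$ by $$x\oplus y:=(x\wedge y')\vee y \quad\text{and}\quad x\odot y:=(x\vee y')\wedge y$$ for all $x,y\in L$. Then $$\mathbf{N}(\mathcal{L}):=((L,\vee,\odot,0,1),(L,\wedge,\oplus,1,0),{}')$$ is a coupled right orthosemiring.
   Context: An orthomodular lattice is an algebra $\mathcal{L}=(L,\vee,\wedge,',0,1)$ of type $(2,2,1,0,0)$ such that: (i) $(L,\vee,\wedge,0,1)$ is a bounded lattice (with least element $0$ and greatest element $1$); (ii) $x\le y$ implies $x'\ge y'$; (iii) $(x')'=x$; (iv) $x\le y$ implies $y=x\vee(y\wedge x')$. A right near semiring is an algebra $(R,+,\cdot,0,1)$ of type $(2,2,0,0)$ such that: (i) $(R,+,0)$ is a commutative monoid; (ii) $(R,\cdot)$ is a groupoid (a set with a binary operation, not necessarily associative) with two-sided neutral element $1$; (iii) $(x+y)z=xz+yz$ for all $x,y,z\in R$; (iv) $x0=0x=0$ for all $x\in R$. In a tuple $(R,\wedge,\ast,1,0)$ the additive operation is $\wedge$ with neutral element $1$, the multiplicative operation is $\ast$ with neutral element $0$, and the absorbing element in (iv) is $1$. A right near semiring $(R,+,\cdot,0,1)$ is $\vee$-semilattice ordered if there is a join-semilattice operation $\vee$ on $R$ such that $x+y=x\vee y$ and $xy\le y$ for all $x,y\in R$, with respect to the induced order ($x\le y$ iff $x\vee y=y$). It is $\wedge$-semilattice ordered if there is a meet-semilattice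 operation $\wedge$ on $R$ such that $x+y=x\wedge y$ and $xy\ge y$ for all $x,y\in R$, with respect to the induced order ($x\le y$ iff $x\wedge y=x$). A coupled right orthosemiring is an ordered triple $((R,\vee,\cdot,0,1),(R,\wedge,\ast,1,0),\alpha)$ such that: (R1) $(R,\vee,\wedge)$ is a lattice; (R2) $(R,\vee,\cdot,0,1)$ is a $\vee$-semilattice ordered right near semiring; (R3) $(R,\wedge,\ast,1,0)$ is a $\wedge$-semilattice ordered right near semiring; (R4) $\alpha$ is an involutive isomorphism between $(R,\vee,\cdot,0,1)$ and $(R,\wedge,\ast,1,0)$, i.e. $\alpha:R\to R$ satisfies $\alpha(\alpha(x))=x$, $\alpha(x\vee y)=\alpha(x)\wedge\alpha(y)$, $\alpha(xy)=\alpha(x)\ast\alpha(y)$ for all $x,y\in R$, and $\alpha(0)=1$, $\alpha(1)=0$; (R5) $(x\wedge\alpha(y))\vee y=x\ast y$ for all $x,y\in R$; (R6) $y\ast(x\wedge y)=y$ for all $x,y\in R$. *)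

(* Defs.v *)
From mathcomp Require Import all_boot.

Set Implicit Arguments.
Unset Strict Implicit.
Unset Printing Implicit Defensive.

(* The structures below are unbundled predicates on an
   arbitrary carrier: Order.TBLattice would force a choiceType with a boolean
   order, and a coupled orthosemiring puts two algebras, ordered through dual
   operations, on one carrier. *)

Section Orders.
Variables (R : Type) (op : R -> R -> R).

Definition semilattice : Prop :=
  [/\ associative op, commutative op & idempotent_op op].

(* The order induced by [op], read as a join, resp. as a meet. In a lattice
   the two readings coincide by absorption. *)
Definition join_le (x y : R) : Prop := op x y = y.
Definition meet_le (x y : R) : Prop := op x y = x.

End Orders.

Record lattice (R : Type) (join meet : R -> R -> R) : Prop := Lattice {
  lattice_joinA : associative join;
  lattice_joinC : commutative join;
  lattice_meetA : associative meet;
  lattice_meetC : commutative meet;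
  lattice_joinK : forall x y, join x (meet x y) = x;
  lattice_meetK : forall x y, meet x (join x y) = x
}.

Record bounded_lattice (R : Type) (join meet : R -> R -> R) (bot top : R) :
  Prop := BoundedLattice {
  bounded_lattice_lattice : lattice join meet;
  bounded_lattice_bot : forall x, join_le join bot x;
  bounded_lattice_top : forall x, join_le join x top
}.

Record orthomodular_lattice (L : Type) (join meet : L -> L -> L)
    (compl : L -> L) (bot top : L) : Prop := OrthomodularLattice {
  oml_bounded : bounded_lattice join meet bot top;
  oml_antitone : forall x y,
    join_le join x y -> join_le join (compl y) (compl x);
  oml_involutive : involutive compl;
  oml_orthomodular : forall x y,
    join_le join x y -> y = join x (meet y (compl x))
}.

Record near_semiring_ops (R : Type) := NearSemiringOps {
  ns_add : R -> R -> R;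
  ns_mul : R -> R -> R;
  ns_zero : R;
  ns_one : R
}.

(* Multiplication is not assumed associative. *)
Record right_near_semiring (R : Type) (A : near_semiring_ops R) : Prop :=
  RightNearSemiring {
  rns_addA : associative (ns_add A);
  rns_addC : commutative (ns_add A);
  rns_add0 : left_id (ns_zero A) (ns_add A);
  rns_mul1l : left_id (ns_one A) (ns_mul A);
  rns_mul1r : right_id (ns_one A) (ns_mul A);
  rns_mulDl : left_distributive (ns_mul A) (ns_add A);
  rns_mul0l : left_zero (ns_zero A) (ns_mul A);
  rns_mul0r : right_zero (ns_zero A) (ns_mul A)
}.

Definition join_semilattice_ordered (R : Type) (A : near_semiring_ops R) :
  Prop :=
  exists join : R -> R -> R,
    [/\ semilattice join,
        forall x y, ns_add A x y = join x y
      & forall x y, join_le join (ns_mul A x y) y].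

Definition meet_semilattice_ordered (R : Type) (A : near_semiring_ops R) :
  Prop :=
  exists meet : R -> R -> R,
    [/\ semilattice meet,
        forall x y, ns_add A x y = meet x y
      & forall x y, meet_le meet y (ns_mul A x y)].

Record involutive_isomorphism (R : Type) (A B : near_semiring_ops R)
    (alpha : R -> R) : Prop := InvolutiveIsomorphism {
  iso_involutive : involutive alpha;
  iso_add : {morph alpha : x y / ns_add A x y >-> ns_add B x y};
  iso_mul : {morph alpha : x y / ns_mul A x y >-> ns_mul B x y};
  iso_zero : alpha (ns_zero A) = ns_zero B;
  iso_one : alpha (ns_one A) = ns_one B
}.

(* The triple (A, B, alpha) with A = (R, \/, ., 0, 1), B = (R, /\, *, 1, 0);
   [cro_zero] and [cro_one] say that B has the constants of A, swapped. *)
Record coupled_right_orthosemiring (R : Type) (A B : near_semiring_ops R)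
    (alpha : R -> R) : Prop := CoupledRightOrthosemiring {
  cro_zero : ns_zero B = ns_one A;
  cro_one : ns_one B = ns_zero A;
  cro_lattice : lattice (ns_add A) (ns_add B);
  cro_join_rns : right_near_semiring A;
  cro_join_ordered : join_semilattice_ordered A;
  cro_meet_rns : right_near_semiring B;
  cro_meet_ordered : meet_semilattice_ordered B;
  cro_iso : involutive_isomorphism A B alpha;
  cro_sasaki : forall x y, ns_add A (ns_add B x (alpha y)) y = ns_mul B x y;
  cro_absorb : forall x y, ns_mul B y (ns_add B x y) = y
}.

Definition oplus (L : Type) (join meet : L -> L -> L) (compl : L -> L)
  (x y : L) : L := join (meet x (compl y)) y.

Definition odot (L : Type) (join meet : L -> L -> L) (compl : L -> L)
  (x y : L) : L := meet (join x (compl y)) y.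

(* Main.v *)
Require Import Defs.
From mathcomp Require Import all_boot.

Set Implicit Arguments.
Unset Strict Implicit.
Unset Printing Implicit Defensive.

(** The polynomial [x (.) z = (x \/ z') /\ z] is the Sasaki projection onto [z].
    Orthomodularity makes it left adjoint to [y |-> (y /\ z) \/ z'], so it
    preserves joins; this is right distributivity. The order dual of an
    orthomodular lattice is orthomodular and exchanges [(.)] with [(+)], which
    turns every law of the first near semiring into a law of the second. *)

Section Lattice.
Context {L : Type} {join meet : L -> L -> L}.
Hypothesis hL : lattice join meet.

(** Both absorption laws give [x = join x (meet x (join x x)) = join x x]. *)
Lemma lattice_joinI : idempotent_op join.
Proof. by move=> x; rewrite -{2}(lattice_meetK hL x x) (lattice_joinK hL). Qed.

Lemma join_leP x y : join_le join x y <-> meet_le meet x y.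
Proof.
rewrite /join_le /meet_le; split=> [<-|<-]; first exact: (lattice_meetK hL).
by rewrite (lattice_joinC hL) (lattice_meetC hL) (lattice_joinK hL).
Qed.

Lemma join_le_refl x : join_le join x x.
Proof. exact: lattice_joinI. Qed.

Lemma join_le_trans x y z :
  join_le join x y -> join_le join y z -> join_le join x z.
Proof. by rewrite /join_le => xy <-; rewrite (lattice_joinA hL) xy. Qed.

Lemma join_le_anti x y : join_le join x y -> join_le join y x -> x = y.
Proof. by rewrite /join_le => xy <-; rewrite (lattice_joinC hL). Qed.

Lemma join_le_joinl x y : join_le join x (join x y).
Proof. by rewrite /join_le (lattice_joinA hL) lattice_joinI. Qed.

Lemma join_le_joinr x y : join_le join y (join x y).
Proof. by rewrite (lattice_joinC hL x); apply: join_le_joinl. Qed.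

Lemma join_le_join x y z :
  join_le join x z -> join_le join y z -> join_le join (join x y) z.
Proof. by rewrite /join_le -(lattice_joinA hL) => xz ->. Qed.

Lemma join_le_meetl x y : join_le join (meet x y) x.
Proof. by rewrite /join_le (lattice_joinC hL) (lattice_joinK hL). Qed.

Lemma join_le_meetr x y : join_le join (meet x y) y.
Proof. by rewrite (lattice_meetC hL); apply: join_le_meetl. Qed.

Lemma join_le_meet x y z :
  join_le join z x -> join_le join z y -> join_le join z (meet x y).
Proof.
move=> /join_leP zx /join_leP zy; apply/join_leP.
by rewrite /meet_le (lattice_meetA hL) zx.
Qed.

Lemma lattice_dual : lattice meet join.
Proof. by case: hL => *; split. Qed.

End Lattice.

Section Orthomodular.
Context {L : Type} {join meet : L -> L -> L} {compl : L -> L} {bot top : L}.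
Hypothesis hL : orthomodular_lattice join meet compl bot top.

Let lat : lattice join meet := bounded_lattice_lattice (oml_bounded hL).
Let le0 x : join_le join bot x := bounded_lattice_bot (oml_bounded hL) x.
Let le1 x : join_le join x top := bounded_lattice_top (oml_bounded hL) x.
Local Notation "x <=: y" := (join_le join x y) (at level 70).
Local Notation "x (.) y" := (odot join meet compl x y) (at level 40).

Lemma compl_join x y : compl (join x y) = meet (compl x) (compl y).
Proof.
apply: (join_le_anti lat).
  apply: (join_le_meet lat); apply: (oml_antitone hL).
    exact: (join_le_joinl lat).
  exact: (join_le_joinr lat).
(* Writing the smaller side as a double complement turns each remaining inequality into one that
   antitonicity reverses. *)
rewrite -[X in X <=: _](oml_involutive hL); apply: (oml_antitone hL).
apply: (join_le_join lat).
  rewrite -[X in X <=: _](oml_involutive hL).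
  exact/(oml_antitone hL)/(join_le_meetl lat).
rewrite -[X in X <=: _](oml_involutive hL).
exact/(oml_antitone hL)/(join_le_meetr lat).
Qed.

Lemma compl_meet x y : compl (meet x y) = join (compl x) (compl y).
Proof.
by rewrite -[RHS](oml_involutive hL) compl_join !(oml_involutive hL).
Qed.

Lemma compl_bot : compl bot = top.
Proof.
apply: (join_le_anti lat); first exact: le1.
by rewrite -(oml_involutive hL top); apply: (oml_antitone hL).
Qed.

(** Complementing the orthomodular law for [compl x <=: compl y] gives this form, which is the law
    of the dual lattice. *)
Lemma meet_orthomodular x y :
  y <=: x -> y = meet x (join y (compl x)).
Proof.
move=> /(oml_antitone hL)/(oml_orthomodular hL)/(congr1 compl).
by rewrite compl_join compl_meet !(oml_involutive hL).
Qed.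

Lemma orthomodular_lattice_dual :
  orthomodular_lattice meet join compl top bot.
Proof.
have dualE x y : join_le meet x y <-> y <=: x.
  rewrite {1}/join_le (lattice_meetC lat).
  by apply: iff_sym; apply: (join_leP lat).
split=> [|x y /dualE yx||x y /dualE].
- by split=> [|x|x]; [exact: lattice_dual | exact/dualE | exact/dualE].
- exact/dualE/(oml_antitone hL).
- exact: (oml_involutive hL).
- exact: meet_orthomodular.
Qed.

(** This is the orthomodular law for [x <=: top]. *)
Lemma join_compl x : join x (compl x) = top.
Proof.
rewrite [RHS](oml_orthomodular hL (le1 x)) (lattice_meetC lat).
by congr join; apply/esym/(join_leP lat).
Qed.

Lemma odot_adjoint x y z :
  x (.) z <=: y <-> x <=: join (compl z) (meet z y).
Proof.
split=> h.
  apply: (join_le_trans lat (join_le_joinl lat x (compl z))).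
  (* Since [compl z] lies below [join x (compl z)], the latter equals [join (compl z) (x (.) z)]. *)
  rewrite (oml_orthomodular hL (join_le_joinr lat x (compl z))).
  rewrite (oml_involutive hL); apply: (join_le_join lat).
    exact: (join_le_joinl lat).
  apply: (join_le_trans lat _ (join_le_joinr lat _ _)).
  exact: (join_le_meet lat (join_le_meetr lat _ _) h).
apply: (join_le_trans lat _ (join_le_meetr lat z y)).
(* Dually, [meet z y] is the meet of [z] with [join (meet z y) (compl z)]. It remains to join both
   sides of [h] with [compl z]. *)
rewrite [X in _ <=: X](meet_orthomodular (join_le_meetl lat z y)).
apply: (join_le_meet lat); first exact: (join_le_meetr lat).
apply: (join_le_trans lat (join_le_meetl lat _ _)).
rewrite (lattice_joinC lat (meet z y)).
exact: (join_le_join lat h (join_le_joinl lat _ _)).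
Qed.

Lemma odot_joinDl : left_distributive (odot join meet compl) join.
Proof.
move=> x y z; apply: (join_le_anti lat).
  apply/odot_adjoint/(join_le_join lat); apply/odot_adjoint.
    exact: (join_le_joinl lat).
  exact: (join_le_joinr lat).
(* Monotonicity follows from the unit of the adjunction,
   [v <=: join (compl z) (meet z (v (.) z))]. *)
have mono u v : u <=: v -> u (.) z <=: v (.) z.
  move=> uv; apply/odot_adjoint/(join_le_trans lat uv)/odot_adjoint.
  exact: (join_le_refl lat).
apply: (join_le_join lat); apply: mono; first exact: (join_le_joinl lat).
exact: (join_le_joinr lat).
Qed.

Lemma odot_le x y : x (.) y <=: y.
Proof. exact: (join_le_meetr lat). Qed.

Lemma compl_odot x y :
  compl (x (.) y) = oplus join meet compl (compl x) (compl y).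
Proof. by rewrite /odot compl_meet compl_join. Qed.

End Orthomodular.

(** Kept general in the orthomodular lattice so that it also applies to the dual. *)
Lemma odot_right_near_semiring (L : Type) (join meet : L -> L -> L)
    (compl : L -> L) (bot top : L)
    (hL : orthomodular_lattice join meet compl bot top) :
  right_near_semiring (NearSemiringOps join (odot join meet compl) bot top).
Proof.
have lat := bounded_lattice_lattice (oml_bounded hL).
have le0 := bounded_lattice_bot (oml_bounded hL).
have le1 := bounded_lattice_top (oml_bounded hL).
(* In the dual, [compl_bot] and [join_compl] become [compl top = bot] and [meet x (compl x) = bot];
   these give the right unit and the left zero. *)
have hD := orthomodular_lattice_dual hL.
have meet1 x : meet x top = x by apply/(join_leP lat).
have meet0 x : meet x bot = bot.
  by rewrite (lattice_meetC lat); apply/(join_leP lat).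
split=> /= [||x|x|x||x|x].
- exact: (lattice_joinA lat).
- exact: (lattice_joinC lat).
- exact: le0.
- have -> : odot join meet compl top x = meet top x.
    by rewrite /odot (lattice_joinC lat) le1.
  by rewrite (lattice_meetC lat).
- by rewrite /odot (compl_bot hD) (lattice_joinC lat) le0.
- exact: odot_joinDl hL.
- by rewrite /odot le0 (lattice_meetC lat) (join_compl hD).
- exact: meet0.
Qed.

Theorem theorem9 (L : Type) (join meet : L -> L -> L) (compl : L -> L)
    (bot top : L)
    (hL : orthomodular_lattice join meet compl bot top) :
  coupled_right_orthosemiring
    (NearSemiringOps join (odot join meet compl) bot top)
    (NearSemiringOps meet (oplus join meet compl) top bot)
    compl.
Proof.
have lat := bounded_lattice_lattice (oml_bounded hL).
have hD := orthomodular_lattice_dual hL.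
have latD := lattice_dual lat.
(* The Sasaki identity (R5) is the definition of [oplus] and is closed here by computation. *)
split=> //=.
- exact: odot_right_near_semiring hL.
- exists join; split=> //=; last exact: odot_le hL.
  by split; [exact: lattice_joinA lat | exact: lattice_joinC lat
            | exact: lattice_joinI lat].
(* With [join] and [meet] exchanged, [odot] unfolds to the same term as [oplus]. *)
- exact: odot_right_near_semiring hD.
- exists meet; split=> //= [|x y].
    by split; [exact: lattice_meetA lat | exact: lattice_meetC lat
              | exact: lattice_joinI latD].
  by rewrite /meet_le (lattice_meetC lat); apply: (odot_le hD).
- split=> /=.
  + exact: oml_involutive hL.
  + exact: compl_join hL.
  + exact: compl_odot hL.
  + exact: compl_bot hL.
  + exact: compl_bot hD.
(* Up to commutativity of [join], (R6) is the orthomodular law for [meet x y] below [y]. *)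
- move=> x y; rewrite /oplus (lattice_joinC lat).
  by rewrite -(oml_orthomodular hL (join_le_meetr lat x y)).
Qed.
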